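(* For a permutation $\pi=\pi_1\cdots\pi_m$ let $m_{I}(\pi)=\#\{i:\exists j>i,\ \pi_j>\pi_i\}$ (non-right-to-left maxima) and $m_{II}(\pi)=\#\{i:\exists j<i,\ \pi_j>\pi_i\}$ (non-left-to-right maxima). Let $UD_m$ (resp. $DU_m$) be the set of up-down (resp. down-up) permutations of $\{1,\dots,m\}$. Define $$A(t,p,q)=1+\sum_{n\ge1}\sum_{\pi\in UD_{2n}}p^{m_{II}(\pi)}q^{m_I(\pi)}\frac{t^{2n}}{(2n)!},\qquad B(t,p,q)=\sum_{n\ge1}\sum_{\pi\in UD_{2n-1}}p^{m_{II}(\pi)}q^{m_I(\pi)}\frac{t^{2n-1}}{(2n-1)!},$$ $$C(t,p,q)=1+\sum_{n\ge1}\sum_{\pi\in DU_{2n}}p^{m_{II}(\pi)}q^{m_I(\pi)}\frac{t^{2n}}{(2n)!},\qquad D(t,p,q)=\sum_{n\ge1}\sum_{\pi\in DU_{2n-1}}p^{m_{II}(\pi)}q^{m_I(\pi)}\frac{t^{2n-1}}{(2n-1)!}.$$ Then $$A(t,p,q)=1+\int_0^t\Big[(\sec(pqs))^{\frac1p+\frac1q}\int_0^{qs}(\sec(pz))^{-\frac1p}dz\Big]ds,$$ $$B(t,p,q)=t+\int_0^t\Big[(\sec(pqs))^{\frac1p+\frac1q}\int_0^{qs}(\sec(pz))^{-\frac1p}dz\int_0^{ps}(\sec(qz))^{-\frac1q}dz\Big]ds,$$ $$C(t,p,q)=1+\int_0^t\Big[(\sec(pqs))^{\frac1p+\frac1q}\int_0^{ps}(\sec(qz))^{-\frac1q}dz\Big]ds,\qquad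 D(t,p,q)=\int_0^t(\sec(pqz))^{\frac1p+\frac1q}dz.$$
   Context: Up-down: $\pi_1<\pi_2>\pi_3<\cdots$; down-up: $\pi_1>\pi_2<\pi_3>\cdots$. ($m_I$, $m_{II}$ are the numbers of occurrences of the quadrant marked mesh patterns MMP$(1,0,0,0)$ and MMP$(0,1,0,0)$.) The identities are of formal power series in $t$, where $(\sec(au))^{b}=\exp(b\log\sec(au))$ is expanded as a power series in $u$ (all coefficients are polynomials in $p,q$). *)

(* Defs.v *)
From HB Require Import structures.
From mathcomp Require Import all_boot all_order all_algebra all_fingroup.

Set Implicit Arguments.
Unset Strict Implicit.
Unset Printing Implicit Defensive.

Import GRing.Theory.
Local Open Scope ring_scope.

(* Positions and values are 0-based: pi_(i+1) = s i + 1, so an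
   even i here is an odd position there. *)
Definition up_down (m : nat) (s : 'S_m) : bool :=
  [forall i : 'I_m, forall j : 'I_m, (j == i.+1 :> nat) ==>
     (if odd i then (s j < s i)%N else (s i < s j)%N)].

Definition down_up (m : nat) (s : 'S_m) : bool :=
  [forall i : 'I_m, forall j : 'I_m, (j == i.+1 :> nat) ==>
     (if odd i then (s i < s j)%N else (s j < s i)%N)].

Definition mI (m : nat) (s : 'S_m) : nat :=
  #|[set i : 'I_m | [exists j : 'I_m, (i < j)%N && (s i < s j)%N]]|.

Definition mII (m : nat) (s : 'S_m) : nat :=
  #|[set i : 'I_m | [exists j : 'I_m, (j < i)%N && (s i < s j)%N]]|.

Section FormalPowerSeries.

Variable K : fieldType.

(* K is of characteristic 0 wherever this is used; p and q may be elements of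
   any such K, in particular the indeterminates of K = Q(p, q).
   A formal power series is its sequence of coefficients; the pointwise
   product of functions is not used, multiplication is fps_mul. *)
Definition fps : Type := nat -> K.

Implicit Types (f g : fps) (a : K).

Definition fps_one : fps := fun n => (n == 0%N)%:R.

Definition fps_X : fps := fun n => (n == 1%N)%:R.

Definition fps_add f g : fps := fun n => f n + g n.

Definition fps_sub f g : fps := fun n => f n - g n.

Definition fps_cst_mul a f : fps := fun n => a * f n.

Definition fps_mul f g : fps := fun n => \sum_(i < n.+1) f i * g (n - i)%N.

Definition fps_pow f (k : nat) : fps := iter k (fps_mul f) fps_one.

(* f(g(u)), meaningful only when g has zero constant term: g ^ k then
   contributes to the coefficient of u ^ n only for k <= n. *)
Definition fps_comp f g : fps :=
  fun n => \sum_(k < n.+1) f k * fps_pow g k n.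

(* f(a u) *)
Definition fps_scale a f : fps := fun n => a ^+ n * f n.

(* The primitive of f vanishing at 0, as a series in the upper bound. Hence
   the integral of f from 0 to a * s is fps_scale a (fps_int f), in s. *)
Definition fps_int f : fps :=
  fun n => if n is k.+1 then f k / k.+1%:R else 0.

(* 1 / f = 1 / (1 - (1 - f)), for f with constant term 1. *)
Definition fps_inv f : fps := fps_comp (fun _ => 1) (fps_sub fps_one f).

Definition fps_exp : fps := fun n => (n`!%:R)^-1.

Definition fps_log1p : fps :=
  fun n => if n is k.+1 then (-1) ^+ k / k.+1%:R else 0.

(* log f, for f with constant term 1. *)
Definition fps_log f : fps := fps_comp fps_log1p (fps_sub f fps_one).

Definition fps_cos : fps :=
  fun n => if odd n then 0 else (-1) ^+ n./2 / n`!%:R.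

Definition fps_sec : fps := fps_inv fps_cos.

(* (sec(a u))^b = exp (b log (sec (a u))), as a series in u. *)
Definition sec_pow (a b : K) : fps :=
  fps_comp fps_exp (fps_cst_mul b (fps_log (fps_scale a fps_sec))).

(* The coefficient of t ^ m contributed by a class P of permutations. *)
Definition egf_coef (P : forall m, 'S_m -> bool) (p q : K) (m : nat) : K :=
  (\sum_(s : 'S_m | P m s) p ^+ mII s * q ^+ mI s) / m`!%:R.

Definition Aser (p q : K) : fps := fun m =>
  if m == 0%N then 1 else if odd m then 0 else egf_coef up_down p q m.

Definition Bser (p q : K) : fps := fun m =>
  if odd m then egf_coef up_down p q m else 0.

Definition Cser (p q : K) : fps := fun m =>
  if m == 0%N then 1 else if odd m then 0 else egf_coef down_up p q m.

Definition Dser (p q : K) : fps := fun m =>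
  if odd m then egf_coef down_up p q m else 0.

End FormalPowerSeries.

(* Main.v *)
(* Splitting a permutation at its maximum [m], as [l m r], adds [size l] to [m_I] of [r]
   and [size r] to [m_II] of [l], and fixes the parity of [size l]. For exponential
   generating functions this gives
     A'(t,p,q) = B(qt,p,1) A(pt,1,q),    B'(t,p,q) = 1 + B(qt,p,1) B(pt,1,q),
     C'(t,p,q) = C(qt,p,1) B(pt,1,q),    D'(t,p,q) = C(qt,p,1) A(pt,1,q).
   At [p = q = 1] the second equation makes [B] the tangent. At [q = 1] or [p = 1] the
   others then become first-order linear equations, solved by
     C(z,p,1) = (sec pz)^(1/p),   A(z,1,q) = (sec qz)^(1/q),
     B(z,p,1) = (sec pz)^(1/p) int_0^z (sec pw)^(-1/p) dw,  and symmetrically B(z,1,q). *)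

Require Import Defs.
From mathcomp Require Import all_boot all_order all_algebra all_fingroup.
From HB Require Import structures.
From mathcomp Require Import boolp ring.

Import GRing.Theory.
Local Open Scope ring_scope.

(** * The ring of formal power series *)

Section FpsRing.

Variable K : fieldType.
Implicit Types f g h : fps K.

(** Equality of coefficient sequences is not decidable constructively, so the [eqType] and
    [choiceType] structures demanded by the ring hierarchy are the classical ones. *)
HB.instance Definition _ := gen_eqMixin (fps K).
HB.instance Definition _ := gen_choiceMixin (fps K).

Fact fps_addA : associative (@fps_add K).
Proof. by move=> f g h; apply/funext=> n; rewrite /fps_add addrA. Qed.
Fact fps_addC : commutative (@fps_add K).
Proof. by move=> f g; apply/funext=> n; rewrite /fps_add addrC. Qed.
Fact fps_add0 : left_id ((fun=> 0) : fps K) (@fps_add K).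
Proof. by move=> f; apply/funext=> n; rewrite /fps_add add0r. Qed.
Fact fps_addN : left_inverse ((fun=> 0) : fps K) (fun f n => - f n) (@fps_add K).
Proof. by move=> f; apply/funext=> n; rewrite /fps_add addNr. Qed.

HB.instance Definition _ :=
  GRing.isZmodule.Build (fps K) fps_addA fps_addC fps_add0 fps_addN.

Fact fps_mulC : commutative (@fps_mul K).
Proof.
move=> f g; apply/funext=> n; rewrite /fps_mul (reindex_inj rev_ord_inj) /=.
by apply: eq_bigr => i _; rewrite subSS subKn 1?mulrC // -ltnS.
Qed.

(* The coefficients up to [n] of [f] and of the polynomial [\poly_(i < n.+1) f i]
   agree, so associativity is inherited from polynomials. *)
Fact fps_mulE_poly f g n i : (i <= n)%N ->
  fps_mul f g i = (\poly_(i < n.+1) f i * \poly_(i < n.+1) g i)`_i.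
Proof.
move=> le_in; rewrite coefM; apply: eq_bigr => j _.
by rewrite !coef_poly ltnS (leq_trans (leq_ord j)) // ltnS (leq_trans (leq_subr _ _)).
Qed.

Fact fps_mulA : associative (@fps_mul K).
Proof.
move=> f g h; apply/funext=> n.
have E (u v : fps K) : \sum_(i < n.+1) u i * fps_mul v h (n - i)%N
    = (\poly_(i < n.+1) u i * (\poly_(i < n.+1) v i * \poly_(i < n.+1) h i))`_n.
  rewrite coefM; apply: eq_bigr => i _.
  by rewrite coef_poly ltn_ord (@fps_mulE_poly _ _ n) ?leq_subr.
rewrite {1}/fps_mul E mulrA coefM /fps_mul; apply: eq_bigr => i _.
by rewrite -(@fps_mulE_poly _ _ n) 1?leq_ord // coef_poly ltnS leq_subr.
Qed.

Fact fps_mul1 : left_id (fps_one K) (@fps_mul K).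
Proof.
move=> f; apply/funext=> n; rewrite /fps_mul big_ord_recl /= subn0 mul1r.
by rewrite big1 ?addr0 // => i _; rewrite mul0r.
Qed.

Fact fps_mulDl : left_distributive (@fps_mul K) (@fps_add K).
Proof.
move=> f g h; apply/funext=> n; rewrite /fps_mul /fps_add -big_split.
by apply: eq_bigr => i _; rewrite mulrDl.
Qed.

Fact fps_1_neq0 : fps_one K != 0 :> fps K.
Proof.
apply/eqP => /(congr1 (fun f => f 0%N)) /eqP; exact/negP/oner_neq0.
Qed.

HB.instance Definition _ := GRing.Zmodule_isComNzRing.Build (fps K)
  fps_mulA fps_mulC fps_mul1 fps_mulDl fps_1_neq0.

End FpsRing.

(** * Derivation, composition and linear differential equations *)

Section FpsCalculus.

Variable K : fieldType.
Implicit Types (f g h y z : fps K) (a b c : K).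

Definition fps_deriv f : fps K := fun n => n.+1%:R * f n.+1.

Lemma fps_mulE f g : fps_mul f g = f * g.
Proof. by []. Qed.

Lemma coef0_fpsM f g : (f * g : fps K) 0%N = f 0%N * g 0%N.
Proof. by rewrite [LHS]big_ord1. Qed.

Lemma fps_derivD f g : fps_deriv (f + g) = fps_deriv f + fps_deriv g.
Proof. by apply/funext => n; apply: mulrDr. Qed.

Lemma fps_derivN f : fps_deriv (- f) = - fps_deriv f.
Proof. by apply/funext => n; apply: mulrN. Qed.

Lemma fps_deriv1 : fps_deriv 1 = 0.
Proof. by apply/funext => n; apply: mulr0. Qed.

Lemma fps_derivM f g : fps_deriv (f * g) = fps_deriv f * g + f * fps_deriv g.
Proof.
apply/funext => n.
(* The factor [n.+1] is split as [i + (n.+1 - i)]. The first half loses its term [i = 0] and becomes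
   [f' g], the second loses its last term and becomes [f g']. *)
transitivity (\sum_(i < n.+2) (i%:R * f i * g (n.+1 - i)%N
                              + f i * ((n.+1 - i)%:R * g (n.+1 - i)%N))).
  rewrite [LHS]mulr_sumr; apply: eq_bigr => i _.
  have -> : n.+1%:R = i%:R + (n.+1 - i)%:R :> K by rewrite -natrD subnKC ?leq_ord.
  by ring.
rewrite big_split; congr (_ + _).
  by rewrite big_ord_recl /= !mul0r add0r; apply: eq_bigr => i _; rewrite subSS.
rewrite big_ord_recr /= subnn mul0r mulr0 addr0; apply: eq_bigr => i _.
by rewrite subSn ?leq_ord.
Qed.

(** Turns scaling by a constant into a ring product, so that the ring laws apply to it. *)
Lemma fps_cst_mulE a f : fps_cst_mul a f = fps_cst_mul a 1 * f.
Proof.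
apply/funext => n; rewrite [RHS]big_ord_recl /= big1 ?addr0 ?subn0.
  by rewrite /fps_cst_mul mulr1.
by move=> i _; rewrite /fps_cst_mul /= [a * _]mulr0 mul0r.
Qed.

Lemma fps_deriv_cst_mul a f : fps_deriv (fps_cst_mul a f) = fps_cst_mul a (fps_deriv f).
Proof. by apply/funext => n; apply: mulrCA. Qed.

Lemma fps_powE f k : fps_pow f k = f ^+ k.
Proof. by elim: k => // k IHk; rewrite exprS -IHk. Qed.

Lemma fps_derivX f k : fps_deriv (f ^+ k.+1) = (f ^+ k * fps_deriv f) *+ k.+1.
Proof.
elim: k => [|k IHk]; first by rewrite expr1 expr0 mul1r.
by rewrite exprS fps_derivM IHk exprS; ring.
Qed.

Lemma coef_fpsX_small h k n : h 0%N = 0 -> (n < k)%N -> (h ^+ k : fps K) n = 0.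
Proof.
move=> h0; elim: k n => // k IHk n ltnk; rewrite exprS.
rewrite [LHS]big_ord_recl h0 mul0r add0r big1 // => i _.
rewrite IHk ?mulr0 // lift0 ltn_subLR ?ltn_ord //.
by rewrite ltnS in ltnk; rewrite addSn ltnS (leq_trans ltnk) ?leq_addl.
Qed.

(** Since [h ^+ k] starts at order [k], the cut-off may be raised to any [N]; different coefficients
    then share one summation range. *)
Lemma coef_fps_comp f h N n : h 0%N = 0 -> (n <= N)%N ->
  fps_comp f h n = \sum_(k < N.+1) f k * (h ^+ k : fps K) n.
Proof.
move=> h0 lenN; rewrite /fps_comp (big_ord_widen N.+1 (fun k => f k * fps_pow h k n)) //.
rewrite big_mkcond; apply: eq_bigr => k _; rewrite fps_powE.
by case: ltnP => // ltnk; rewrite coef_fpsX_small ?mulr0.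
Qed.

Lemma coef0_fps_comp f h : fps_comp f h 0%N = f 0%N.
Proof. by rewrite /fps_comp big_ord1 mulr1. Qed.

Lemma coef_fps_mul_comp f g h N n : h 0%N = 0 -> (n <= N)%N ->
  (g * fps_comp f h : fps K) n = \sum_(k < N.+1) f k * (g * h ^+ k : fps K) n.
Proof.
move=> h0 lenN.
under [RHS]eq_bigr do rewrite mulr_sumr.
rewrite exchange_big; apply: eq_bigr => i _ /=.
rewrite (@coef_fps_comp _ _ N) // ?(leq_trans (leq_subr _ _)) // mulr_sumr.
by apply: eq_bigr => k _; rewrite mulrCA.
Qed.

(** Chain rule, obtained term by term from the power rule; the factor [k.+1] it produces is absorbed
    into the coefficients of [fps_deriv f]. *)
Lemma fps_deriv_comp f h : h 0%N = 0 ->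
  fps_deriv (fps_comp f h) = fps_comp (fps_deriv f) h * fps_deriv h.
Proof.
move=> h0; apply/funext => n; rewrite mulrC (@coef_fps_mul_comp _ _ _ n) //.
rewrite /fps_deriv (@coef_fps_comp _ _ n.+1) // big_ord_recl expr0 mulr0 add0r.
rewrite mulr_sumr; apply: eq_bigr => k _; rewrite lift0 mulrCA.
rewrite -[_ * (h ^+ _ : fps K) _]/(fps_deriv (h ^+ k.+1) n) fps_derivX.
rewrite mulrC -mulrA mulrC mulrA.
(* The multiple [*+] is taken in the ring of series and has to be read off coefficientwise. *)
suff E m (g : fps K) : (g *+ m : fps K) n = m%:R * g n.
  by rewrite E [fps_deriv h * _]mulrC; ring.
elim: m => [|m IHm]; first by rewrite mul0r.
by rewrite mulrSr -natr1 mulrDl mul1r -IHm.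
Qed.

(** Here [f] is the geometric series 1 / (1 - a x). The case [a = 1] serves for [fps_inv], the case
    [a = -1] for the derivative of log(1 + x). *)
Lemma fps_comp_geom a f h : h 0%N = 0 -> f 0%N = 1 -> (forall k, f k.+1 = a * f k) ->
  (1 - fps_cst_mul a h) * fps_comp f h = 1.
Proof.
move=> h0 f0 fS; rewrite mulrBl mul1r; apply/eqP; rewrite subr_eq; apply/eqP.
apply/funext => n.
rewrite -[LHS]/(fps_comp f h n) -[RHS]/((1 : fps K) n + (fps_cst_mul a h * fps_comp f h : fps K) n).
rewrite (@coef_fps_mul_comp _ _ _ n) // (@coef_fps_comp _ _ n.+1) //.
rewrite big_ord_recl f0 mul1r expr0; congr (_ + _).
apply: eq_bigr => k _.
rewrite lift0 fS exprS fps_cst_mulE -[_ * h * _]mulrA -fps_cst_mulE /fps_cst_mul.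
by rewrite mulrCA mulrA.
Qed.

Lemma fps_scale1 a : fps_scale a 1 = 1.
Proof.
apply/funext => -[|n]; first exact: mulr1.
exact: mulr0.
Qed.

Lemma fps_scale1r f : fps_scale 1 f = f.
Proof. by apply/funext => n; rewrite /fps_scale expr1n mul1r. Qed.

Lemma fps_scaleM a f g : fps_scale a (f * g) = fps_scale a f * fps_scale a g.
Proof.
apply/funext => n; rewrite /fps_scale [LHS]mulr_sumr; apply: eq_bigr => i _.
by rewrite mulrACA -exprD subnKC ?leq_ord.
Qed.

Lemma fps_scaleA a b f : fps_scale a (fps_scale b f) = fps_scale (b * a) f.
Proof. by apply/funext => n; rewrite /fps_scale exprMn mulrCA mulrA. Qed.

Lemma coef0_fps_scale a f : fps_scale a f 0%N = f 0%N.
Proof. exact: mul1r. Qed.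

Lemma fps_deriv_scale a f :
  fps_deriv (fps_scale a f) = fps_cst_mul a (fps_scale a (fps_deriv f)).
Proof.
by apply/funext => n; rewrite /fps_deriv /fps_scale /fps_cst_mul exprS; ring.
Qed.

(** * Characteristic zero: primitives, linear differential equations, logarithm, exponential and
    secant *)

Hypothesis charK : [pchar K] =i pred0.

Lemma natrS_neq0 n : n.+1%:R != 0 :> K.
Proof. by rewrite (pcharf0P K).1. Qed.

Lemma fps_int_deriv f g : f 0%N = 0 -> fps_deriv f = g -> f = fps_int g.
Proof.
move=> f0 <-; apply/funext => -[|n] //=.
by rewrite /fps_deriv mulrC mulKf ?natrS_neq0.
Qed.

Lemma fps_deriv_int f : fps_deriv (fps_int f) = f.
Proof. by apply/funext => n; rewrite /fps_deriv /= mulrC divfK ?natrS_neq0. Qed.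

(** The equation expresses [n.+1%:R * f n.+1] through earlier coefficients of [f], and [n.+1%:R] is
    invertible. *)
Lemma fps_ode0 g f : f 0%N = 0 -> fps_deriv f = g * f -> f = 0.
Proof.
move=> f0 Df; suff H n m : (m <= n)%N -> f m = 0.
  by apply/funext => n; apply: (H n).
elim: n m => [|n IHn] m; first by rewrite leqn0 => /eqP ->.
rewrite leq_eqVlt ltnS => /predU1P[->|]; last exact: IHn.
apply: (mulfI (natrS_neq0 n)); rewrite mulr0.
rewrite -[LHS]/(fps_deriv f n) Df [LHS]big1 // => i _.
by rewrite IHn ?mulr0 ?leq_subr.
Qed.

(** The tool behind the secant identities below: both sides are shown to solve one linear equation
    with the same constant term. *)
Lemma fps_ode_unique (c : fps K) g y z : y 0%N = z 0%N ->
  fps_deriv y = c + g * y -> fps_deriv z = c + g * z -> y = z.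
Proof.
move=> yz0 Dy Dz; apply/eqP; rewrite -subr_eq0; apply/eqP; apply: (@fps_ode0 g).
  by rewrite -[LHS]/(y 0%N - z 0%N) yz0 subrr.
by rewrite fps_derivD fps_derivN Dy Dz; ring.
Qed.

(** The derivative of log(1 + x) has coefficients [(-1) ^+ k], hence is 1 / (1 + x); at [x = f - 1]
    this is 1 / f, multiplied out to avoid a quotient. *)
Lemma fps_log_deriv f : f 0%N = 1 -> fps_log f 0%N = 0 /\
  f * fps_deriv (fps_log f) = fps_deriv f.
Proof.
move=> f0; split; first exact: coef0_fps_comp.
have h0 : (f - 1 : fps K) 0%N = 0 by rewrite -[LHS]/(f 0%N - 1) f0 subrr.
rewrite -[fps_log f]/(fps_comp (@fps_log1p K) (f - 1)) fps_deriv_comp // mulrA.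
have -> : fps_deriv (f - 1) = fps_deriv f.
  by rewrite fps_derivD fps_derivN fps_deriv1 subr0.
have log1pE k : fps_deriv (@fps_log1p K) k = (-1) ^+ k.
  by rewrite /fps_deriv /= mulrC divfK ?natrS_neq0.
have := @fps_comp_geom (-1) (fps_deriv (@fps_log1p K)) (f - 1) h0.
rewrite (_ : 1 - fps_cst_mul (-1) (f - 1) = f); last first.
  apply/funext => n; rewrite -[LHS]/((1 : fps K) n - (-1 * (f n - (1 : fps K) n))).
  by ring.
move=> ->; [exact: mul1r | by rewrite log1pE | by move=> k; rewrite !log1pE exprS].
Qed.

Lemma fps_deriv_exp : fps_deriv (@fps_exp K) = @fps_exp K.
Proof.
apply/funext => n; rewrite /fps_deriv /fps_exp factS natrM invfM mulrA.
by rewrite divff ?mul1r ?natrS_neq0.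
Qed.

Lemma fps_deriv2_cos : fps_deriv (fps_deriv (@fps_cos K)) = - @fps_cos K.
Proof.
apply/funext => n; rewrite -[RHS]/(- fps_cos K n) /fps_deriv /fps_cos /= negbK.
case: odd => /=; first by rewrite !mulr0 oppr0.
rewrite exprS !factS !natrM !invfM.
move: (natrS_neq0 n) (natrS_neq0 n.+1); move: n.+1%:R n.+2%:R n`!%:R^-1 => x y z x0 y0.
by field; rewrite x0 y0.
Qed.

Lemma fps_cos_sec : @fps_cos K * @fps_sec K = 1.
Proof.
have c0 : fps_cos K 0%N = 1 by rewrite /fps_cos /= fact0 divr1.
have := @fps_comp_geom 1 (fun=> 1) (1 - @fps_cos K).
rewrite (_ : fps_cst_mul 1 _ = 1 - @fps_cos K); last by apply/funext => n; apply: mul1r.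
rewrite subKr; apply=> // [|k]; last by rewrite mulr1.
by rewrite -[LHS]/(1 - fps_cos K 0%N) c0 subrr.
Qed.

(** * Powers of the secant and their differential equations *)

Section SecPow.

(** Later [T] is [Bser 1 1], which satisfies exactly this Riccati equation; the tangent is thus
    never introduced as an explicit series. *)
Variable T : fps K.
Hypotheses (T0 : T 0%N = 0) (DT : fps_deriv T = 1 + T * T).

(* The hypotheses on [T] characterise the tangent [- cos' / cos], which is [(log sec)']. *)
Lemma fps_deriv_log_sec a :
  fps_deriv (fps_log (fps_scale a (@fps_sec K))) = fps_cst_mul a (fps_scale a T).
Proof.
set c := @fps_cos K; set s := @fps_sec K.
have cs : c * s = 1 := fps_cos_sec.
have Dcs : fps_deriv c * s + c * fps_deriv s = 0.
  by rewrite -fps_derivM cs fps_deriv1.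
have Ds : fps_deriv s = - fps_deriv c * s * s.
  have -> : fps_deriv s = (c * s) * fps_deriv s by rewrite cs mul1r.
  have /eqP := Dcs; rewrite addrC addr_eq0 => /eqP E.
  by rewrite mulrAC E; ring.
have ET : T = - fps_deriv c * s.
  (* Two solutions of y' = 1 + y^2 have a difference d with d' = (sum of the two) d, a homogeneous
     linear equation. *)
  apply/eqP; rewrite -subr_eq0; apply/eqP.
  apply: (@fps_ode0 (T + (- fps_deriv c * s))).
    rewrite -[LHS]/(T 0%N - (- fps_deriv c * s : fps K) 0%N) T0 coef0_fpsM.
    rewrite -[(- _ : fps K) 0%N]/(- (1%:R * 0)).
    by rewrite mulr0 oppr0 mul0r subrr.
  rewrite fps_derivD fps_derivN fps_derivM fps_derivN DT fps_deriv2_cos Ds -/c.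
  rewrite opprK cs; ring.
have s0 : fps_scale a s 0%N = 1.
  by rewrite coef0_fps_scale [LHS]coef0_fps_comp.
(* Multiplying by cos(a u) cancels the factor sec(a u) in front of the derivative of the
   logarithm. *)
have [_] := fps_log_deriv _ s0; rewrite fps_deriv_scale => /(congr1 (fun f => fps_scale a c * f)).
rewrite mulrA -fps_scaleM cs fps_scale1 mul1r => ->.
rewrite Ds ET fps_cst_mulE [in RHS]fps_cst_mulE mulrCA -fps_scaleM; congr (_ * fps_scale _ _).
by rewrite -[RHS]mul1r -cs; ring.
Qed.

Lemma sec_pow0 a b : sec_pow a b 0%N = 1.
Proof. by rewrite /sec_pow coef0_fps_comp /fps_exp fact0 invr1. Qed.

Lemma fps_deriv_sec_pow a b :
  fps_deriv (sec_pow a b) = fps_cst_mul (b * a) (fps_scale a T) * sec_pow a b.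
Proof.
rewrite /sec_pow fps_deriv_comp.
  rewrite fps_deriv_exp fps_deriv_cst_mul fps_deriv_log_sec mulrC; congr (_ * _).
  by apply/funext => n; rewrite /fps_cst_mul mulrA.
by rewrite /fps_cst_mul [fps_log _ _]coef0_fps_comp mulr0.
Qed.

Lemma sec_powD a b c : sec_pow a b * sec_pow a c = sec_pow a (b + c).
Proof.
apply: (@fps_ode_unique 0 (fps_cst_mul ((b + c) * a) (fps_scale a T))).
- by rewrite coef0_fpsM !sec_pow0 mulr1.
- rewrite fps_derivM !fps_deriv_sec_pow add0r.
  have -> : fps_cst_mul ((b + c) * a) (fps_scale a T)
     = fps_cst_mul (b * a) (fps_scale a T) + fps_cst_mul (c * a) (fps_scale a T).
    by apply/funext => n; rewrite /fps_cst_mul mulrDl; apply: mulrDl.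
  by ring.
- by rewrite fps_deriv_sec_pow add0r.
Qed.

Lemma sec_powr0 a : sec_pow a 0 = 1.
Proof.
apply: (@fps_ode_unique 0 0); first exact: sec_pow0.
  rewrite fps_deriv_sec_pow add0r mul0r fps_cst_mulE.
  rewrite (_ : fps_cst_mul 0 1 = 0) ?mul0r //.
  by apply/funext => n; apply: mul0r.
by rewrite fps_deriv1 mul0r addr0.
Qed.

Lemma fps_scale_sec_pow a b c : fps_scale c (sec_pow a b) = sec_pow (a * c) b.
Proof.
apply: (@fps_ode_unique 0 (fps_cst_mul (b * (a * c)) (fps_scale (a * c) T))).
- by rewrite coef0_fps_scale !sec_pow0.
- rewrite fps_deriv_scale fps_deriv_sec_pow add0r fps_scaleM fps_cst_mulE mulrA -fps_cst_mulE.
  congr (_ * _); rewrite -fps_scaleA.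
  by apply/funext => n; rewrite /fps_cst_mul /fps_scale; ring.
- by rewrite fps_deriv_sec_pow add0r.
Qed.

(** Since (log sec(a u))' = a tan(a u), the exponent [a^-1] is what makes the coefficient exactly
    tan(a u). *)
Lemma sec_pow_ode a y : a != 0 -> y 0%N = 1 -> fps_deriv y = fps_scale a T * y ->
  y = sec_pow a a^-1.
Proof.
move=> a0 y0 Dy; apply: (@fps_ode_unique 0 (fps_scale a T)); rewrite ?add0r //.
  by rewrite sec_pow0.
rewrite fps_deriv_sec_pow mulVf //; congr (_ * _).
by apply/funext => n; apply: mul1r.
Qed.

(** Variation of constants: the homogeneous solution times the primitive of its inverse. *)
Lemma sec_pow_int_ode a y : a != 0 -> y 0%N = 0 -> fps_deriv y = 1 + fps_scale a T * y ->
  y = sec_pow a a^-1 * fps_int (sec_pow a (- a^-1)).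
Proof.
move=> a0 y0 Dy; apply: (@fps_ode_unique 1 (fps_scale a T)) => //.
  by rewrite coef0_fpsM mulr0.
rewrite fps_derivM fps_deriv_int sec_powD subrr sec_powr0 fps_deriv_sec_pow mulVf //.
rewrite (_ : fps_cst_mul 1 _ = fps_scale a T); first by ring.
by apply/funext => n; apply: mul1r.
Qed.

End SecPow.

End FpsCalculus.

Arguments fps_deriv {K} f n.

(** * Words and their splitting at the maximum *)

Section Words.

Implicit Types (b : bool) (l r s t : seq nat).

Fixpoint alternating b t : bool :=
  if t is x :: t' then
    (if t' is y :: _ then if b then (x < y)%N else (y < x)%N else true)
      && alternating (~~ b) t'
  else true.

(** The word form of [mI]; applied to the reversed word it gives [mII], so one statistic serves for
    both. *)
Fixpoint nonrlmax t : nat :=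
  if t is x :: t' then (has (ltn x) t' + nonrlmax t')%N else 0%N.

Lemma alternating_cons2 b x y t :
  alternating b [:: x, y & t] =
    (if b then (x < y)%N else (y < x)%N) && alternating (~~ b) (y :: t).
Proof. by []. Qed.

Lemma alternatingP b t :
  reflect (forall i, (i.+1 < size t)%N ->
             if b (+) odd i then (nth 0%N t i < nth 0%N t i.+1)%N
             else (nth 0%N t i.+1 < nth 0%N t i)%N)
          (alternating b t).
Proof.
elim: t b => [|x [|y t] IHt] b; try by left.
rewrite [alternating b _]/=; apply: (iffP andP).
  case=> xy /IHt tP [_|i]; first by rewrite addbF.
  by move=> /= lti; have := tP i lti; case: (b); case: odd.
move=> tP; split; first by have := tP 0%N isT; rewrite addbF.
by apply/IHt => i lti; have := tP i.+1 lti => /=; case: (b); case: odd.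
Qed.

Lemma nonrlmaxE t :
  nonrlmax t = (\sum_(0 <= i < size t) has (ltn (nth 0 t i)) (drop i.+1 t))%N.
Proof.
elim: t => [|x t IHt]; first by rewrite big_nil.
by rewrite big_nat_recl //= drop0 IHt.
Qed.

Lemma nonrlmax_revE t :
  nonrlmax (rev t) = (\sum_(0 <= i < size t) has (ltn (nth 0 t i)) (take i t))%N.
Proof.
elim/last_ind: t => [|t x IHt]; first by rewrite big_nil.
rewrite rev_rcons size_rcons big_nat_recr //= has_rev IHt addnC.
rewrite nth_rcons ltnn eqxx -cats1 take_size_cat //.
congr (_ + _)%N; apply: eq_big_nat => i /andP[_ lti].
by rewrite nth_cat lti takel_cat // ltnW.
Qed.

(** Each letter of [l] sees the larger [m] on its right, [m] sees nothing larger, and letters of [r]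
    only look inside [r]. *)
Lemma nonrlmax_cat_max m l r : all (gtn m) l -> all (gtn m) r ->
  nonrlmax (l ++ m :: r) = (size l + nonrlmax r)%N.
Proof.
move=> + rm; elim: l => [_|x l IHl /= /andP[xm lm]] /=.
  rewrite (_ : has _ r = false) //; apply/hasP => -[y /(allP rm) /= ym].
  by rewrite ltnNge ltnW.
by rewrite has_cat /= xm orbT IHl.
Qed.

(** A step into [m] must be an ascent and a step out of it a descent; each forces the same parity of
    [size l], and [r] then starts with an ascent. With [l] and [r] both empty there is no such step,
    hence the [nilp] clause. *)
Lemma alternating_cat_max b m l r : all (gtn m) l -> all (gtn m) r ->
  alternating b (l ++ m :: r) =
    [&& alternating b l, alternating true r & (odd (size l) == b) || nilp (l ++ r)].
Proof.
move=> + rm; elim: l b => [b _|x [|y l] IHl b /andP[xm lm]].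
- case: r rm => [|y r] /=; first by rewrite orbT.
  case/andP=> ym _; case: b => /=; last by rewrite ym andbT.
  by rewrite ltnNge ltnW ?andbF.
- rewrite /= in xm; have := IHl (~~ b) isT; rewrite !cat0s => E.
  rewrite [LHS]alternating_cons2 E /=; case: b {E}; rewrite ?xm ?andbT //=.
  by rewrite ltnNge ltnW //= andbF.
- rewrite !cat_cons !alternating_cons2 -!cat_cons IHl // -!andbA; congr [&& _, _, _ & _].
  by rewrite /= !orbF; case: b; case: odd.
Qed.

Lemma alternating_map f b t : {in t &, {mono f : x y / (x < y)%N}} ->
  alternating b (map f t) = alternating b t.
Proof.
elim: t b => // x [|y t] IHt b // fP.
rewrite [LHS]alternating_cons2 -map_cons IHt; last first.
  by move=> u v ut vt; apply: fP; rewrite inE ?ut ?vt orbT.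
by rewrite !fP // !inE eqxx ?orbT.
Qed.

Lemma nonrlmax_map f t : {in t &, {mono f : x y / (x < y)%N}} ->
  nonrlmax (map f t) = nonrlmax t.
Proof.
elim: t => // x t IHt fP /=; rewrite IHt; last first.
  by move=> u v ut vt; apply: fP; rewrite inE ?ut ?vt orbT.
congr (nat_of_bool _ + _)%N; rewrite has_map; apply: eq_in_has => y yt /=.
by rewrite fP // !inE ?eqxx // yt orbT.
Qed.

End Words.

(** * Sums over permutations seen as words *)

Section SumOverWords.

Variable V : nmodType.
Implicit Type F : seq nat -> V.

Definition perm_word {m} (s : 'S_m) : seq nat := [seq val (s i) | i <- enum 'I_m].

Lemma sum_perm_word F m :
  \sum_(s : 'S_m) F (perm_word s) = \sum_(t <- permutations (iota 0 m)) F t.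
Proof.
rewrite -(big_map (@perm_word m) xpredT); apply: perm_big.
set W := map _ _.
have uW : uniq W.
  rewrite map_inj_uniq ?index_enum_uniq // => s1 s2 /eq_in_map E.
  by apply/permP => i; apply: val_inj; apply: E; rewrite mem_enum.
have sub : {subset W <= permutations (iota 0 m)}.
  move=> _ /mapP[s _ ->]; rewrite mem_permutations -val_enum_ord /perm_word.
  rewrite (map_comp val s); apply: perm_map; apply: uniq_perm.
  - by rewrite (map_inj_uniq perm_inj) enum_uniq.
  - exact: enum_uniq.
  - by move=> i; rewrite mem_enum -[i](permKV s) map_f ?mem_enum.
apply: uniq_perm; rewrite ?permutations_uniq //.
(* Both lists have m! entries, so the inclusion of the duplicate-free [W] is an equality of sets. *)
have [] // := uniq_min_size uW sub.
rewrite size_permutations ?iota_uniq // size_iota size_map.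
by rewrite -(card_Sn m) cardE size_filter -[X in (_ <= X)%N]count_predT sub_count.
Qed.

(** Only the relative order of letters matters to [F], and [nth 0%N s] relabels the ranks
    increasingly by the letters of [s]. *)
Lemma sum_permutations_mono F s : sorted ltn s ->
    (forall f t, {in t &, {mono f : x y / (x < y)%N}} -> F (map f t) = F t) ->
  \sum_(t <- permutations s) F t = \sum_(t <- permutations (iota 0 (size s))) F t.
Proof.
move=> s_sorted Fmono.
have nth_mono : {in gtn (size s) &, {mono nth 0%N s : i j / (i < j)%N}}.
  have nth_homo := sorted_ltn_nth ltn_trans 0%N s_sorted.
  move=> i j ltis ltjs; case: (ltngtP i j) => [||->]; last by rewrite ltnn.
    exact: nth_homo.
  by move=> ltji; rewrite ltnNge ltnW // nth_homo.
have ltn_size t i : perm_eq t (iota 0 (size s)) -> i \in t -> (i < size s)%N.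
  by move=> ts; rewrite (perm_mem ts) mem_iota.
transitivity (\sum_(t <- map (map (nth 0%N s)) (permutations (iota 0 (size s)))) F t).
  apply: perm_big; apply: uniq_perm; rewrite ?permutations_uniq //.
    rewrite map_inj_in_uniq ?permutations_uniq // => t1 t2.
    rewrite !mem_permutations => t1s t2s.
    apply: (@inj_in_map _ _ _ (gtn (size s))); try by apply/allP => i; apply: ltn_size.
    move=> i j ltis ltjs; move/eqP.
    by rewrite nth_uniq ?(sorted_uniq ltn_trans ltnn) // => /eqP.
  move=> t; rewrite mem_permutations; apply/(perm_iotaP 0%N)/mapP => -[I].
    by move=> *; exists I; rewrite ?mem_permutations.
  by rewrite mem_permutations; exists I.
rewrite big_map; apply: eq_big_seq => t; rewrite mem_permutations => ts.
by apply: Fmono => i j /(ltn_size _ _ ts) ltis /(ltn_size _ _ ts); apply: nth_mono.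
Qed.

(** The largest letter is [n]; [A] is the set of letters standing before it. *)
Lemma sum_permutations_split_max F n :
  \sum_(t <- permutations (iota 0 n.+1)) F t =
  \sum_(A : {set 'I_n}) \sum_(l <- permutations (map val (enum A)))
     \sum_(r <- permutations (map val (enum (~: A)))) F (l ++ n :: r).
Proof.
pose pre t := [set i : 'I_n | val i \in take (index n t) t].
rewrite (partition_big pre xpredT) //; apply: eq_bigr => A _ /=.
rewrite -big_filter -big_allpairs_dep; apply: perm_big.
have memA (B : {set 'I_n}) x :
    (x \in map val (enum B)) = (if insub x is Some i then i \in B else false).
  case: insubP => [i _ <-|ltxn]; first by rewrite mem_map ?mem_enum //; apply: val_inj.
  by apply: contraNF ltxn => /mapP[i _ ->]; rewrite /= ltn_ord.
have uA (B : {set 'I_n}) : uniq (map val (enum B)).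
  by rewrite map_inj_uniq ?enum_uniq //; apply: val_inj.
have nA (B : {set 'I_n}) l : perm_eq l (map val (enum B)) -> n \notin l.
  by move=> lB; rewrite (perm_mem lB) memA insubF // ltnn.
have index_n (B : {set 'I_n}) l r : perm_eq l (map val (enum B)) -> index n (l ++ n :: r) = size l.
  by move=> lB; rewrite index_cat (negPf (nA _ _ lB)) /= eqxx addn0.
apply: uniq_perm.
- by rewrite filter_uniq ?permutations_uniq.
(* The position of [n] in the word recovers [size l], so the cut into [l] and [r] is unique. *)
- apply: allpairs_uniq; rewrite ?permutations_uniq //.
  move=> [l1 r1] [l2 r2] /allpairsP[[l1' r1'] /= [l1A r1A [-> ->]]].
  case/allpairsP=> [[l2' r2'] /= [l2A r2A [-> ->]]] E.
  rewrite !mem_permutations in l1A l2A.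
  have sz : size l1' = size l2' by rewrite -(index_n _ _ r1' l1A) E (index_n _ _ _ l2A).
  by move/eqP: E; rewrite eqseq_cat // => /andP[/eqP -> /eqP[->]].
move=> t; rewrite mem_filter mem_permutations; apply/andP/allpairsP.
  case=> /eqP preA; rewrite -[0%N :: _]/(iota 0 n.+1) => tP.
  have ut : uniq t by rewrite (perm_uniq tP) iota_uniq.
  have memt x : (x \in t) = (x < n.+1)%N by rewrite (perm_mem tP) mem_iota.
  have nt : n \in t by rewrite memt.
  have : t = take (index n t) t ++ n :: drop (index n t).+1 t.
    by rewrite -{2}(nth_index n nt) -drop_nth ?index_mem // cat_take_drop.
  move: preA ut memt; rewrite /pre; move: (take _ _) (drop _ _) => l r + + + tE.
  rewrite {t tP nt}tE => lA; rewrite cat_uniq /= negb_or => /and4P[ul /andP[nl lr] nr ur] memt.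
  have ltn_l x : x \in l -> (x < n)%N.
    move=> xl; have := memt x; rewrite mem_cat xl ltnS leq_eqVlt => /esym/predU1P[xn|//].
    by rewrite -xn xl in nl.
  have ltn_r x : x \in r -> (x < n)%N.
    move=> xr; have := memt x; rewrite mem_cat inE xr !orbT ltnS leq_eqVlt => /esym/predU1P[xn|//].
    by rewrite -xn xr in nr.
  exists (l, r); split; rewrite //= mem_permutations; apply: uniq_perm; rewrite ?uA // => x.
    rewrite memA; case: insubP => [i _ <-|]; first by rewrite -lA inE.
    by apply: contraNF => /ltn_l.
  rewrite memA; case: insubP => [i ltxn ix|]; last by apply: contraNF => /ltn_r.
  have := memt x; rewrite mem_cat inE ltnS ltnW // (ltn_eqF ltxn) -lA !inE ix /=.
  case: (boolP (x \in l)) => //= xl _.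
  by apply: contraNF lr => xr; apply/hasP; exists x.
case=> [[l r] /= []]; rewrite !mem_permutations => lA rA ->; split.
  apply/eqP/setP => i; rewrite inE (index_n _ _ _ lA) take_size_cat // (perm_mem lA).
  by rewrite mem_map ?mem_enum //; apply: val_inj.
rewrite -[0%N :: _]/(iota 0 n.+1); apply: uniq_perm; rewrite ?iota_uniq //.
  rewrite cat_uniq /= (perm_uniq lA) (perm_uniq rA) !uA (nA _ _ rA) /= (negPf (nA _ _ lA)) !andbT.
  apply/hasPn => x /=; rewrite (perm_mem rA) (perm_mem lA) !memA.
  by case: insub => // i; rewrite inE.
move=> x; rewrite mem_cat inE (perm_mem rA) (perm_mem lA) !memA mem_iota /= add0n ltnS leq_eqVlt.
case: insubP => [i -> _|/negPf ->]; last by rewrite orbF.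
by rewrite inE orbCA orbN !orbT.
Qed.

End SumOverWords.

(** * The generating functions *)

Section PermWords.

Variable m : nat.
Implicit Type s : 'S_m.

Lemma size_perm_word s : size (perm_word s) = m.
Proof. by rewrite size_map size_enum_ord. Qed.

Lemma nth_perm_word s (i : 'I_m) : nth 0%N (perm_word s) i = s i.
Proof. by rewrite (nth_map i) ?size_enum_ord // nth_ord_enum. Qed.

Lemma alternating_perm_word b s :
  alternating b (perm_word s) =
    [forall i : 'I_m, forall j : 'I_m, (j == i.+1 :> nat) ==>
       (if b (+) odd i then (s i < s j)%N else (s j < s i)%N)].
Proof.
apply/alternatingP/'forall_'forall_implyP => [altP i j /eqP ji|altP i].
  by rewrite -!nth_perm_word ji; apply: altP; rewrite size_perm_word -ji.
rewrite size_perm_word => lti.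
have /= := altP (Ordinal (ltnW lti)) (Ordinal lti) (eqxx _).
by rewrite -!nth_perm_word.
Qed.

Lemma up_down_perm_word s : up_down s = alternating true (perm_word s).
Proof.
rewrite alternating_perm_word; apply: eq_forallb => i; apply: eq_forallb => j.
by rewrite /=; case: odd.
Qed.

Lemma down_up_perm_word s : down_up s = alternating false (perm_word s).
Proof. by rewrite alternating_perm_word. Qed.

Lemma mI_perm_word s : mI s = nonrlmax (perm_word s).
Proof.
rewrite nonrlmaxE size_perm_word big_mkord /mI -sum1dep_card big_mkcond /=.
apply: eq_bigr => i _; rewrite nth_perm_word.
rewrite (_ : [exists j, _] = has (ltn (s i)) (drop i.+1 (perm_word s))); first by case: has.
apply/existsP/(has_nthP 0%N) => [[j /andP[ltij sij]]|[k]].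
  exists (j - i.+1)%N; first by rewrite size_drop size_perm_word ltn_sub2r ?(leq_ltn_trans ltij).
  by rewrite nth_drop subnKC // nth_perm_word.
rewrite size_drop size_perm_word ltn_subRL nth_drop => ltk sk.
pose j := Ordinal ltk; exists j; apply/andP; split; last by rewrite -(nth_perm_word s j).
by rewrite /= addSn ltnS leq_addr.
Qed.

Lemma mII_perm_word s : mII s = nonrlmax (rev (perm_word s)).
Proof.
rewrite nonrlmax_revE size_perm_word big_mkord /mII -sum1dep_card big_mkcond /=.
apply: eq_bigr => i _; rewrite nth_perm_word.
rewrite (_ : [exists j, _] = has (ltn (s i)) (take i (perm_word s))); first by case: has.
have szi : size (take i (perm_word s)) = i by rewrite size_takel // size_perm_word ltnW.
apply/existsP/(has_nthP 0%N) => [[j /andP[ltji sij]]|[k]].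
  by exists j; rewrite ?szi // nth_take // nth_perm_word.
rewrite szi => ltki; rewrite nth_take // => sk.
pose j := Ordinal (ltn_trans ltki (ltn_ord i)); exists j.
by apply/andP; split; last by rewrite -(nth_perm_word s j).
Qed.

End PermWords.

(** * The recurrence at the maximum and its differential form *)

Section AlternatingSeries.

Variable K : fieldType.
Hypothesis charK : [pchar K] =i pred0.
Implicit Types (b e : bool) (p q : K).

Definition alt_weight b p q t : K :=
  if alternating b t then p ^+ nonrlmax (rev t) * q ^+ nonrlmax t else 0.

Definition alt_sum b p q n : K :=
  \sum_(t <- permutations (iota 0 n)) alt_weight b p q t.

(* [b] tells whether the words start with an ascent, [e] whether their length is odd. *)
Definition alt_series b e p q : fps K :=
  fun n => if odd n == e then alt_sum b p q n / n`!%:R else 0.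

Lemma alt_weight_mono b p q f t : {in t &, {mono f : x y / (x < y)%N}} ->
  alt_weight b p q (map f t) = alt_weight b p q t.
Proof.
move=> fP; rewrite /alt_weight alternating_map // -map_rev !nonrlmax_map //.
by move=> x y; rewrite !mem_rev; apply: fP.
Qed.

(** All of [l] counts for [q] and all of [r] counts for [p] because of [m]; what remains to be
    counted is the [p]-statistic inside [l] and the [q]-statistic inside [r], hence the parameters
    1. *)
Lemma alt_weight_cat_max b p q m l r : all (gtn m) l -> all (gtn m) r ->
  alt_weight b p q (l ++ m :: r) =
    if (odd (size l) == b) || nilp (l ++ r) then
      q ^+ size l * alt_weight b p 1 l * (p ^+ size r * alt_weight true 1 q r)
    else 0.
Proof.
move=> lm rm; rewrite /alt_weight alternating_cat_max // rev_cat rev_cons cat_rcons.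
rewrite !nonrlmax_cat_max ?all_rev // size_rev !exprD !expr1n mul1r mulr1.
case: (alternating b l); last by rewrite mulr0 mul0r if_same.
case: (alternating true r); last by rewrite !mulr0 if_same.
by rewrite /= [p ^+ size r * _]mulrC mulrACA [_ * q ^+ size l]mulrC.
Qed.

Lemma sum_alt_weight_set b p q n (A : {set 'I_n}) :
  \sum_(t <- permutations (map val (enum A))) alt_weight b p q t = alt_sum b p q #|A|.
Proof.
rewrite sum_permutations_mono; last exact: alt_weight_mono.
  by rewrite size_map -cardE.
have : subseq (map val (enum A)) (iota 0 n).
  by rewrite -val_enum_ord map_subseq // enumT filter_subseq.
by move/(subseq_sorted ltn_trans); apply; apply: iota_ltn_sorted.
Qed.

Lemma alt_sumS b p q n :
  alt_sum b p q n.+1 = \sum_(k < n.+1)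
    (if (odd k == b) || (n == 0%N) then
       'C(n, k)%:R * (q ^+ k * alt_sum b p 1 k * (p ^+ (n - k) * alt_sum true 1 q (n - k)))
     else 0).
Proof.
(* The contribution of a set [A] of left letters depends only on its cardinality [k], so the
   binomial counts the sets. *)
pose G k : K := if (odd k == b) || (n == 0%N) then
  q ^+ k * alt_sum b p 1 k * (p ^+ (n - k) * alt_sum true 1 q (n - k)) else 0.
transitivity (\sum_(A : {set 'I_n}) G #|A|).
  rewrite [LHS]sum_permutations_split_max; apply: eq_bigr => A _.
  have cardC : (n - #|A|)%N = #|~: A| by rewrite [RHS]cardsCs setCK card_ord.
  have ltn_set (B : {set 'I_n}) l : perm_eq l (map val (enum B)) -> all (gtn n) l.
    by move=> lB; apply/allP => x; rewrite (perm_mem lB) => /mapP[i _ ->] /=.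
  have size_set (B : {set 'I_n}) l : perm_eq l (map val (enum B)) -> size l = #|B|.
    by move=> lB; rewrite (perm_size lB) size_map -cardE.
  transitivity (\sum_(l <- permutations (map val (enum A)))
                \sum_(r <- permutations (map val (enum (~: A))))
     if (odd #|A| == b) || (n == 0%N) then (q ^+ #|A| * alt_weight b p 1 l) *
        (p ^+ #|~: A| * alt_weight true 1 q r) else 0).
    apply: eq_big_seq => l; rewrite mem_permutations => lA.
    apply: eq_big_seq => r; rewrite mem_permutations => rA.
    rewrite alt_weight_cat_max ?(ltn_set _ _ lA) ?(ltn_set _ _ rA) //.
    rewrite /nilp size_cat (size_set _ _ lA) (size_set _ _ rA).
    by rewrite cardsC card_ord.
  rewrite /G cardC; case: ifP => _; last by rewrite big1 // => l _; rewrite big1.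
  rewrite -!sum_alt_weight_set [q ^+ _ * _]mulr_sumr mulr_suml; apply: eq_bigr => l _.
  by rewrite !mulr_sumr.
have ltA (A : {set 'I_n}) : (#|A| < n.+1)%N by rewrite ltnS -[X in (_ <= X)%N]card_ord max_card.
rewrite (partition_big (fun A : {set 'I_n} => Ordinal (ltA A)) xpredT) //=.
apply: eq_bigr => k _; rewrite -[X in 'C(X, _)]card_ord -card_draws.
transitivity (\sum_(A in [set A : {set 'I_n} | #|A| == k]) G k).
  by apply: eq_big => A; rewrite ?inE // => /eqP <-.
rewrite sumr_const /G; case: ifP; rewrite ?mul0rn // => _.
by rewrite [RHS]mulr_natl.
Qed.

Lemma alt_sum0 b p q : alt_sum b p q 0 = 1.
Proof. by rewrite /alt_sum big_seq1 /alt_weight /= mulr1. Qed.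

(** The left part has the parity of [b], and the total length fixes the parity of the right part.
    The one-letter word has an empty left part: for [b = false] the product already counts it, for
    [b = true] it gives the separate summand 1. *)
Lemma fps_deriv_alt_series b e p q :
  fps_deriv (alt_series b e p q) =
    (if b && e then 1 else 0)
    + fps_scale q (alt_series b b p 1)
      * fps_scale p (alt_series true (~~ (e (+) b)) 1 q).
Proof.
apply/funext => n.
set c : fps K := if _ then _ else _.
set P : fps K := _ * _.
rewrite -[RHS]/(c n + P n).
have PE : P n = \sum_(k < n.+1) q ^+ k * alt_series b b p 1 k *
   (p ^+ (n - k) * alt_series true (~~ (e (+) b)) 1 q (n - k)%N) by [].
rewrite {}PE {P} /fps_deriv /alt_series.
(* If [n.+1] has the wrong parity, no [k] gives both factors their prescribed parities, and both
   sides vanish. *)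
case: eqP => [eS|neS]; last first.
  rewrite mulr0 big1 ?addr0 => [|k _].
    rewrite /c; case: ifP => // /andP[_ eT]; rewrite /= eT in neS.
    by case: n neS => //= n _; rewrite /fps_one.
  case: eqP => kb; last by rewrite mulr0 mul0r.
  case: eqP => nkb; last by rewrite !mulr0.
  case: neS; rewrite /= -(subnKC (leq_ord k)) oddD kb nkb.
  by case: (b); case: (e).
rewrite alt_sumS factS natrM invfM mulrCA mulVKf ?natrS_neq0 // mulr_suml.
(* The one-letter word, where the clause [n == 0%N] of the recurrence takes effect. *)
case: n eS => [|n] eS.
  rewrite !big_ord1 /= !alt_sum0 orbT bin0 fact0 /c -eS.
  rewrite subnn !expr0 !divr1 !mul1r.
  by case: (b); rewrite /= ?(mul0r, mulr0, mul1r); [exact/esym/addr0 | exact/esym/add0r].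
rewrite (_ : c n.+1 = 0) ?add0r; last by rewrite /c; case: ifP.
apply: eq_bigr => k _; rewrite orbF.
case: eqP => kb; last by rewrite mulr0 !mul0r.
(* Once [k] and the total length have the right parity, so does the right part. *)
rewrite (_ : odd (n.+1 - k) == _); last first.
  by rewrite oddB ?leq_ord // kb -eS /=; case: (odd n); case: (b).
rewrite -(bin_fact (leq_ord k)) !natrM !invfM.
have : 'C(n.+1, k)%:R != 0 :> K by rewrite (pcharf0P K).1 // -lt0n bin_gt0 leq_ord.
move: ('C(_, _)%:R) (k`!%:R^-1) ((n.+1 - k)`!%:R^-1) => x y z x0.
by field.
Qed.

Lemma egf_coef_up_down p q m : egf_coef up_down p q m = alt_sum true p q m / m`!%:R.
Proof.
rewrite /egf_coef big_mkcond /alt_sum -sum_perm_word; congr (_ / _); apply: eq_bigr => s _.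
by rewrite /alt_weight -up_down_perm_word mI_perm_word mII_perm_word.
Qed.

Lemma egf_coef_down_up p q m : egf_coef down_up p q m = alt_sum false p q m / m`!%:R.
Proof.
rewrite /egf_coef big_mkcond /alt_sum -sum_perm_word; congr (_ / _); apply: eq_bigr => s _.
by rewrite /alt_weight -down_up_perm_word mI_perm_word mII_perm_word.
Qed.

Lemma AserE p q : Aser p q = alt_series true false p q.
Proof.
apply/funext => -[|n]; rewrite /Aser /alt_series ?egf_coef_up_down.
  by rewrite alt_sum0 fact0 divr1.
by rewrite [_ == false]eqbF_neg; case: odd.
Qed.

Lemma BserE p q : Bser p q = alt_series true true p q.
Proof. by apply/funext => n; rewrite /Bser /alt_series egf_coef_up_down eqb_id. Qed.

Lemma CserE p q : Cser p q = alt_series false false p q.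
Proof.
apply/funext => -[|n]; rewrite /Cser /alt_series ?egf_coef_down_up.
  by rewrite alt_sum0 fact0 divr1.
by rewrite [_ == false]eqbF_neg; case: odd.
Qed.

Lemma DserE p q : Dser p q = alt_series false true p q.
Proof. by apply/funext => n; rewrite /Dser /alt_series egf_coef_down_up eqb_id. Qed.

Lemma fps_deriv_Aser p q :
  fps_deriv (Aser p q) = fps_scale q (Bser p 1) * fps_scale p (Aser 1 q).
Proof. by rewrite !AserE BserE fps_deriv_alt_series add0r. Qed.

Lemma fps_deriv_Bser p q :
  fps_deriv (Bser p q) = 1 + fps_scale q (Bser p 1) * fps_scale p (Bser 1 q).
Proof. by rewrite !BserE fps_deriv_alt_series. Qed.

Lemma fps_deriv_Cser p q :
  fps_deriv (Cser p q) = fps_scale q (Cser p 1) * fps_scale p (Bser 1 q).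
Proof. by rewrite !CserE BserE fps_deriv_alt_series add0r. Qed.

Lemma fps_deriv_Dser p q :
  fps_deriv (Dser p q) = fps_scale q (Cser p 1) * fps_scale p (Aser 1 q).
Proof. by rewrite DserE CserE AserE fps_deriv_alt_series add0r. Qed.

End AlternatingSeries.

(** * Solving the differential equations *)

Theorem theorem2 (K : fieldType) (charK : [pchar K] =i pred0) (p q : K)
    (hp : p != 0) (hq : q != 0) :
  [/\ Aser p q =1
        fps_add (fps_one K)
          (fps_int (fps_mul (sec_pow (p * q) (p^-1 + q^-1))
                            (fps_scale q (fps_int (sec_pow p (- p^-1)))))),
      Bser p q =1
        fps_add (fps_X K)
          (fps_int (fps_mul (fps_mul (sec_pow (p * q) (p^-1 + q^-1))
                                     (fps_scale q (fps_int (sec_pow p (- p^-1)))))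
                            (fps_scale p (fps_int (sec_pow q (- q^-1)))))),
      Cser p q =1
        fps_add (fps_one K)
          (fps_int (fps_mul (sec_pow (p * q) (p^-1 + q^-1))
                            (fps_scale p (fps_int (sec_pow q (- q^-1))))))
    & Dser p q =1 fps_int (sec_pow (p * q) (p^-1 + q^-1))].
Proof.
have T0 : Bser 1 1 0%N = 0 :> K by [].
have DT : fps_deriv (Bser 1 1) = 1 + Bser 1 1 * Bser 1 1 :> fps K.
  by rewrite fps_deriv_Bser // !fps_scale1r.
(* With one parameter equal to 1, one factor of the product is the unknown series unscaled and the
   other is the tangent of [p z] or [q z]. *)
have C1 : Cser p 1 = sec_pow p p^-1.
  apply: (sec_pow_ode _ charK _ T0 DT) => //.
  by rewrite fps_deriv_Cser // fps_scale1r mulrC.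
have A1 : Aser 1 q = sec_pow q q^-1.
  apply: (sec_pow_ode _ charK _ T0 DT) => //.
  by rewrite fps_deriv_Aser // fps_scale1r.
have Bp : Bser p 1 = sec_pow p p^-1 * fps_int (sec_pow p (- p^-1)) :> fps K.
  apply: (sec_pow_int_ode _ charK _ T0 DT) => //.
  by rewrite fps_deriv_Bser // fps_scale1r mulrC.
have Bq : Bser 1 q = sec_pow q q^-1 * fps_int (sec_pow q (- q^-1)) :> fps K.
  apply: (sec_pow_int_ode _ charK _ T0 DT) => //.
  by rewrite fps_deriv_Bser // fps_scale1r.
(* Rescaling by [q] and by [p] brings both secants to the common argument p q s, where the exponents
   add. *)
have secD : sec_pow (p * q) (p^-1 + q^-1)
    = fps_scale q (sec_pow p p^-1) * fps_scale p (sec_pow q q^-1) :> fps K.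
  by rewrite !(fps_scale_sec_pow _ charK _ T0 DT) [q * p]mulrC (sec_powD _ charK _ T0 DT).
have intP (f g c : fps K) : f 0%N = c 0%N -> fps_deriv f = fps_deriv c + g ->
    f =1 fps_add c (fps_int g).
  move=> f0 Df n; rewrite -(fps_int_deriv _ charK (f - c) g).
  - by rewrite -[fps_add _ _]/(c + (f - c)) addrC subrK.
  - by rewrite -[LHS]/(f 0%N - c 0%N) f0 subrr.
  - by rewrite fps_derivD fps_derivN Df addrC addKr.
split; rewrite ?fps_mulE.
- apply: intP => //.
  by rewrite fps_deriv1 add0r fps_deriv_Aser // A1 Bp fps_scaleM secD; ring.
- apply: intP => //.
  have -> : fps_deriv (fps_X K) = 1.
    by apply/funext => -[|n]; rewrite /fps_deriv /fps_X /= ?mulr1 ?mulr0.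
  by rewrite fps_deriv_Bser // Bp Bq !fps_scaleM secD; ring.
- apply: intP => //.
  by rewrite fps_deriv1 add0r fps_deriv_Cser // C1 Bq fps_scaleM secD; ring.
(* [Dser] vanishes at 0 and its derivative has no extra summand, so it is directly a primitive. *)
- move=> n; rewrite -(fps_int_deriv _ charK (Dser p q) (sec_pow (p * q) (p^-1 + q^-1))) //.
  by rewrite fps_deriv_Dser // C1 A1 secD.
Qed.
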